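(* Let $\mathcal{A}=\{v_1,\dots,v_n\}\subset\mathbb{R}^m$, $p\in\mathbb{R}^m$, $R:=\max\{\|v_i-p\| : v_i\in\mathcal{A}\}$, $\varepsilon\in(0,1)$, and $\Psi(y):=\frac12\|y-p\|^2$. Let $y^\star$ be the minimizer of $\Psi$ over $\operatorname{conv}(\mathcal{A})$. Let $y_k\in\operatorname{conv}(\mathcal{A})$ and let $\bar y_k\in\arg\min_{y\in\mathcal{A}}\nabla\Psi(y_k)^T(y-y_k)$ be a solution of the Frank--Wolfe subproblem at $y_k$. If $$\nabla\Psi(y_k)^T(y_k-\bar y_k)\le \|y_k-p\|\,\frac{\varepsilon R}{2},$$ then $$\|y_k-p\|\le\|y^\star-p\|+\varepsilon R .$$ Consequently, under the same inequality: if $p\in\operatorname{conv}(\mathcal{A})$, then $\|y_k-p\|\le\varepsilon R$; and if $\|y_k-p\|>\varepsilon R$, then $p\notin\operatorname{conv}(\mathcal{A})$.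
   Context: $\|\cdot\|$ is the Euclidean norm and $\operatorname{conv}(\mathcal{A})$ is the convex hull of the finite set $\mathcal{A}$. Note $\nabla\Psi(y)=y-p$. *)

(* Defs.v *)
From HB Require Import structures.
From mathcomp Require Import all_boot all_order all_algebra.
From mathcomp Require Import all_classical all_reals all_analysis.

Set Implicit Arguments.
Unset Strict Implicit.
Unset Printing Implicit Defensive.

Import Order.TTheory GRing.Theory Num.Theory.
Import numFieldNormedType.Exports.

Local Open Scope classical_set_scope.
Local Open Scope ring_scope.

Section FrankWolfe.
Context {R : realType} {m : nat}.
Implicit Types (x y p : 'rV[R]_m) (A : set 'rV[R]_m) (f : 'rV[R]_m -> R).

Definition dot x y : R := \sum_(i < m) x 0 i * y 0 i.

(* The library norm `|x| on matrices is the sup norm, hence this definition. *)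
Definition enorm x : R := Num.sqrt (dot x x).

Definition gradient f y : 'rV[R]_m := \row_(i < m) 'D_(delta_mx 0 i) f y.

Definition conv_hull A : set 'rV[R]_m :=
  smallest (@convex_set R 'rV[R]_m) A.

Definition argmin A f : set 'rV[R]_m :=
  [set y | A y /\ forall z, A z -> f y <= f z].

Definition Psi p y : R := 2^-1 * enorm (y - p) ^+ 2.

(* The norms are nonnegative, so for n > 0 the unit 0 does not affect the
   maximum; for n = 0 the hull of the points is empty. *)
Definition max_enorm n (v : 'I_n -> 'rV[R]_m) p : R :=
  \big[Num.max/0]_(i < n) enorm (v i - p).

End FrankWolfe.

(* Main.v *)
Require Import Defs.
From mathcomp Require Import all_boot all_order all_algebra.
From mathcomp Require Import all_classical all_reals all_analysis.
From mathcomp Require Import ring lra.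
Import Order.TTheory GRing.Theory Num.Theory.
Import numFieldNormedType.Exports.
Local Open Scope classical_set_scope.
Local Open Scope ring_scope.

(** The gradient of [Psi p] at [yk] is [g := yk - p]. The linear form [dot g]
    attains its minimum over the hull at the vertex [ybar], so the gap
    hypothesis bounds [dot g (yk - z)] for every [z] in the hull. By
    Cauchy-Schwarz [dot g (yk - z) = dot g g - dot g (z - p)] is at least
    [enorm g * (enorm g - enorm (z - p))], hence
    [enorm g <= enorm (z - p) + eps * R / 2]. The claims are the cases
    [z = ystar] and [z = p]. *)

Section EuclideanSpace.
Context {R : realType} {m : nat}.
Implicit Types (x y z p g : 'rV[R]_m) (A : set 'rV[R]_m).

Lemma dotC x y : dot x y = dot y x.
Proof. by apply: eq_bigr => i _; rewrite mulrC. Qed.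

Lemma dotDr x y z : dot x (y + z) = dot x y + dot x z.
Proof. by rewrite -big_split; apply: eq_bigr => i _; rewrite mxE mulrDr. Qed.

Lemma dotZr (a : R) x y : dot x (a *: y) = a * dot x y.
Proof. by rewrite mulr_sumr; apply: eq_bigr => i _; rewrite mxE mulrCA. Qed.

Lemma dotNr x y : dot x (- y) = - dot x y.
Proof. by rewrite -scaleN1r dotZr mulN1r. Qed.

Lemma dotBr x y z : dot x (y - z) = dot x y - dot x z.
Proof. by rewrite dotDr dotNr. Qed.

Lemma dotDl x y z : dot (x + y) z = dot x z + dot y z.
Proof. by rewrite !(dotC _ z) dotDr. Qed.

Lemma dotZl (a : R) x y : dot (a *: x) y = a * dot x y.
Proof. by rewrite !(dotC _ y) dotZr. Qed.

Lemma dot_delta x i : dot x (delta_mx 0 i) = x 0 i.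
Proof.
rewrite /dot (bigD1 i)//= big1 ?addr0 => [|j ji].
  by rewrite mxE !eqxx mulr1.
by rewrite mxE (negbTE ji) andbF mulr0.
Qed.

Lemma dotvv_ge0 x : 0 <= dot x x.
Proof. by apply: sumr_ge0 => i _; rewrite -expr2 sqr_ge0. Qed.

Lemma dotvv_eq0 x : dot x x = 0 -> x = 0.
Proof.
move=> /eqP; rewrite psumr_eq0 => [/allP x0|i _]; last first.
  by rewrite -expr2 sqr_ge0.
apply/rowP => i; apply/eqP; rewrite mxE.
by have := x0 i (mem_index_enum _); rewrite /= mulf_eq0 orbb.
Qed.

Lemma enorm_ge0 x : 0 <= enorm x.
Proof. exact: sqrtr_ge0. Qed.

Lemma enorm_sqr x : enorm x ^+ 2 = dot x x.
Proof. by rewrite sqr_sqrtr// dotvv_ge0. Qed.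

Lemma enorm0 : enorm (0 : 'rV[R]_m) = 0.
Proof. by rewrite /enorm /dot big1 ?sqrtr0// => i _; rewrite mxE mul0r. Qed.

(** Cauchy-Schwarz: the self-product of [dot y y *: x - dot x y *: y] is nonnegative and expands to
    [dot y y * (dot x x * dot y y - dot x y ^+ 2)], whose first factor cancels when positive. *)
Lemma dot_sqr_le x y : dot x y ^+ 2 <= dot x x * dot y y.
Proof.
have [y0|y_neq0] := eqVneq (dot y y) 0.
  rewrite {1}(dotvv_eq0 _ y0) -(scale0r x) dotZr mul0r expr0n.
  by rewrite mulr_ge0 ?dotvv_ge0.
have y_gt0 : 0 < dot y y by rewrite lt_def y_neq0 dotvv_ge0.
have := dotvv_ge0 (dot y y *: x + (- dot x y) *: y).
rewrite dotDl !dotDr !dotZl !dotZr (dotC y x) => h.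
rewrite -subr_ge0 -(pmulr_rge0 _ y_gt0); apply: le_trans h _.
by rewrite le_eqVlt; apply/orP; left; apply/eqP; ring.
Qed.

Lemma dot_le_enorm x y : dot x y <= enorm x * enorm y.
Proof.
rewrite (le_trans (ler_norm _))// -(ler_pXn2r (n := 2)) ?nnegrE//.
  by rewrite real_normK ?num_real// exprMn !enorm_sqr dot_sqr_le.
by rewrite mulr_ge0 ?enorm_ge0.
Qed.

(** [Psi p] is quadratic, so its difference quotient along a basis vector is exactly affine in the
    step [h], with constant term the matching coordinate of [y - p]. *)
Lemma gradient_Psi p y : gradient (Psi p) y = y - p.
Proof.
apply/rowP => i; rewrite mxE /derive; apply: cvg_lim => //.
set d := delta_mx 0 i.
have quotE : \forall h \near (0 : R)^', (y - p) 0 i + 2^-1 * h * dot d d =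
    h^-1 *: ((Psi p \o shift y) (h *: d) - Psi p y).
  near=> h.
  have h0 : h != 0 by near: h; exact: nbhs_dnbhs_neq.
  rewrite /Psi/= !enorm_sqr -addrA; move: (y - p) => w.
  rewrite dotDl !dotDr !dotZl !dotZr (dotC d w) (dot_delta w) /GRing.scale/=.
  by field.
apply: cvg_trans (near_eq_cvg quotE) _.
(* The affine expression is also defined and continuous at [0], so its limit can be taken over full
   neighbourhoods instead of punctured ones. *)
apply: cvg_within_filter.
have : (y - p) 0 i + 2^-1 * h * dot d d @[h --> (0 : R)] -->
    (y - p) 0 i + 2^-1 * 0 * dot d d.
  apply: cvgD; first exact: cvg_cst.
  by apply: cvgMr_tmp; apply: cvgMl_tmp; exact: cvg_id.
by rewrite mulr0 mul0r addr0.
Unshelve. all: by end_near. Qed.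

Lemma convex_halfspace g (c : R) :
  convex_set ([set z | c <= dot g z] : set (convex_lmodType 'rV[R]_m)).
Proof.
move=> x y t; rewrite !inE/= => xc yc; rewrite dotDr !dotZr.
have -> : c = t%:num * c + (1 - t%:num) * c by ring.
by rewrite lerD// ler_wpM2l// subr_ge0.
Qed.

(** The hull lies inside every convex set containing [A], in particular inside this closed
    half-space. *)
Lemma conv_hull_dot_ge A g (c : R) z :
  (forall x, A x -> c <= dot g x) -> conv_hull A z -> c <= dot g z.
Proof.
move=> Ac /(_ [set x | c <= dot g x]); apply; split; last exact: Ac.
exact: convex_halfspace.
Qed.

Lemma enorm_le_of_gap p y z (c : R) : 0 <= c ->
  dot (y - p) (y - z) <= enorm (y - p) * c ->
  enorm (y - p) <= enorm (z - p) + c.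
Proof.
move=> c0.
have -> : y - z = (y - p) - (z - p) by rewrite opprB addrA subrK.
rewrite dotBr -enorm_sqr lerBlDr => gap.
(* The last step cancels a factor [enorm (y - p)], so the case where it vanishes is settled first,
   by nonnegativity of the right-hand side. *)
have [y0|y_neq0] := eqVneq (enorm (y - p)) 0.
  by rewrite y0 addr_ge0 ?enorm_ge0.
have y_gt0 : 0 < enorm (y - p) by rewrite lt_def y_neq0 enorm_ge0.
rewrite -(ler_pM2l y_gt0) -expr2 (le_trans gap)// addrC mulrDr lerD2r.
exact: dot_le_enorm.
Qed.

Lemma max_enorm_ge0 n (v : 'I_n -> 'rV[R]_m) p : 0 <= max_enorm v p.
Proof.
rewrite /max_enorm; elim/big_ind: _ => // [a b a0 _|i _].
  by rewrite le_max a0.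
exact: enorm_ge0.
Qed.

End EuclideanSpace.

Theorem mainTheorem2 (R : realType) (m n : nat) (v : 'I_n -> 'rV[R]_m)
    (p : 'rV[R]_m) (eps : R) (ystar yk ybar : 'rV[R]_m)
    (heps : 0 < eps < 1)
    (hystar : argmin (conv_hull (range v)) (Psi p) ystar)
    (hyk : conv_hull (range v) yk)
    (hybar : argmin (range v)
               (fun y : 'rV[R]_m => dot (gradient (Psi p) yk) (y - yk)) ybar)
    (hgap : dot (gradient (Psi p) yk) (yk - ybar)
              <= enorm (yk - p) * (eps * max_enorm v p / 2)) :
  [/\ enorm (yk - p) <= enorm (ystar - p) + eps * max_enorm v p,
      conv_hull (range v) p -> enorm (yk - p) <= eps * max_enorm v p
    & enorm (yk - p) > eps * max_enorm v p -> ~ conv_hull (range v) p].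
Proof.
move: hybar hgap; rewrite gradient_Psi => -[_ ybar_min] gap.
have epsR_ge0 : 0 <= eps * max_enorm v p.
  by case/andP: heps => /ltW eps_ge0 _; rewrite mulr_ge0 ?max_enorm_ge0.
have bound z : conv_hull (range v) z ->
    enorm (yk - p) <= enorm (z - p) + eps * max_enorm v p.
  move=> hz.
  have ybar_le_z : dot (yk - p) ybar <= dot (yk - p) z.
    (* The half-space has level [dot (yk - p) ybar]; it contains all the points [v i] because the
       shift by [yk] in the subproblem's objective cancels. *)
    apply: conv_hull_dot_ge hz => x /ybar_min.
    by rewrite !dotBr lerD2r.
  have : enorm (yk - p) <= enorm (z - p) + eps * max_enorm v p / 2.
    apply: enorm_le_of_gap; first by rewrite divr_ge0.
    by apply: le_trans gap; rewrite !dotBr lerD2l lerN2.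
  (* The sharper bound with [eps * R / 2] is relaxed to [eps * R], which is nonnegative. *)
  by move/le_trans; apply; lra.
have bound_p : conv_hull (range v) p -> enorm (yk - p) <= eps * max_enorm v p.
  by move/bound; rewrite subrr enorm0 add0r.
split => //; first by apply: bound; case: hystar.
by move=> far /bound_p; rewrite leNgt far.
Qed.
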